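(* Let $e,m,n$ be integers with $2\le m<n\le e-2$, let $k$ be a field, and let $I^e(m,n)$ be the defining ideal of the numerical semigroup ring $k[S^e(m,n)]$. Then $S^e(m,n)$ satisfies Herzog and Stamate's width conjecture, i.e. $$\mu(I^e(m,n))\le\binom{\operatorname{wd}(S^e(m,n))+1}{2}.$$
   Context: For integers $e,m,n$ with $2\le m<n\le e-2$, $S^e(m,n)$ denotes the Sally type numerical semigroup, i.e. the numerical semigroup (submonoid of $(\mathbb N,+)$, with $0\in\mathbb N$) minimally generated by $\{e,e+1,\ldots,2e-1\}\setminus\{e+m,e+n\}$. The width $\operatorname{wd}(S)$ of a numerical semigroup $S$ is the difference between the largest and the smallest element of its minimal generating set. Put $J=\{0,1,\ldots,e-1\}\setminus\{m,n\}$ and $A=k[X_i : i\in J]$. The semigroup ring is $k[S^e(m,n)]=k[t^{e+i} : i\in J]\subset k[t]$, and the defining ideal $I^e(m,n)$ is the kernel of the $k$-algebra homomorphism $\phi:A\to k[t]$, $\phi(X_i)=t^{e+i}$. The ideal is homogeneous for the grading $\deg X_i=e+i$, and $\mu(I^e(m,n))$ denotes its minimal number of generators, i.e. $\dim_k I^e(m,n)/\mathfrak m I^e(m,n)$ where $\mathfrak m=(X_i : i\in J)$. *)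

(* Defs.v *)
From HB Require Import structures.
From mathcomp Require Import all_boot all_order all_algebra.
From mathcomp Require Import mpoly.

Set Implicit Arguments.
Unset Strict Implicit.
Unset Printing Implicit Defensive.

Import GRing.Theory.

Local Open Scope ring_scope.

Definition monoid_gen (G : nat -> Prop) (x : nat) : Prop :=
  exists s : seq nat, (forall y, y \in s -> G y) /\ x = sumn s.

Definition minimal_generating_set (S G : nat -> Prop) : Prop :=
  (forall x, S x <-> monoid_gen G x) /\
  (forall H : nat -> Prop, (forall x, H x -> G x) ->
     (forall x, S x <-> monoid_gen H x) -> forall x, G x -> H x).

(* [is_width S w]: S has a minimal generating set with least element a and
   largest element b, and w = b - a.  Functional by [is_width_uniq]. *)
Definition is_width (S : nat -> Prop) (w : nat) : Prop :=
  exists G : nat -> Prop, minimal_generating_set S G /\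
  exists a b : nat, [/\ G a, G b, forall x, G x -> (a <= x <= b)%N
                      & w = (b - a)%N].

Definition sally_gens (e m n : nat) (x : nat) : Prop :=
  [/\ (e <= x <= 2 * e - 1)%N, x <> (e + m)%N & x <> (e + n)%N].

Definition sally_semigroup (e m n : nat) : nat -> Prop :=
  monoid_gen (sally_gens e m n).

Definition ideal_gen (R : comNzRingType) (G : R -> Prop) (x : R) : Prop :=
  exists (r : nat) (a g : 'I_r -> R),
    (forall i, G (g i)) /\ x = \sum_(i < r) a i * g i.

Definition ideal_prod (R : comNzRingType) (I J : R -> Prop) : R -> Prop :=
  ideal_gen (fun x => exists a b, [/\ I a, J b & x = a * b]).

(* [quotient_dim U W d]: for subspaces W <= U, the k-space U / W has a basis
   of d elements (the classes of the b i).  Functional by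
   [quotient_dim_uniq]; fails for every d if U / W has infinite dimension. *)
Definition quotient_dim (k : fieldType) (V : lmodType k) (U W : V -> Prop)
    (d : nat) : Prop :=
  exists b : 'I_d -> V,
  [/\ forall i, U (b i),
      forall c : 'I_d -> k, W (\sum_(i < d) c i *: b i) -> forall i, c i = 0
    & forall u, U u -> exists c : 'I_d -> k, W (u - \sum_(i < d) c i *: b i)].

Definition irrelevant_ideal (k : fieldType) (N : nat) :
    {mpoly k[N]} -> Prop :=
  ideal_gen (fun p : {mpoly k[N]} => exists i : 'I_N, p = 'X_i).

(* mu(I) = d, where mu(I) = dim_k I / (X_i)I.  Functional by [is_mu_uniq]. *)
Definition is_mu (k : fieldType) (N : nat) (I : {mpoly k[N]} -> Prop)
    (d : nat) : Prop :=
  quotient_dim I (ideal_prod (@irrelevant_ideal k N) I) d.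

Definition sally_index (e m n : nat) : {set 'I_e} :=
  [set i : 'I_e | ((i : nat) != m) && ((i : nat) != n)].

(* The polynomial ring on the variables X_j, j in [sally_index e m n]; its
   'X_i is the variable X_j with j = enum_val i. *)
Definition sally_ring (k : fieldType) (e m n : nat) :=
  {mpoly k[#|sally_index e m n|]}.

Definition sally_phi (k : fieldType) (e m n : nat)
    (p : sally_ring k e m n) : {poly k} :=
  mmap (@polyC k)
    (fun i : 'I_#|sally_index e m n| => 'X^(e + (enum_val i : 'I_e))) p.

Definition sally_ideal (k : fieldType) (e m n : nat) :
    sally_ring k e m n -> Prop :=
  fun p => sally_phi p = 0.

Lemma minimal_generating_set_sub (S G H : nat -> Prop) :
  minimal_generating_set S G -> minimal_generating_set S H ->
  forall x, G x -> H x.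
Proof.
move=> [SG minG] [SH _] g Gg.
have genG y : G y -> S y.
  by move=> Gy; apply/SG; exists [:: y]; split=> [z|] /=;
    rewrite ?addn0 // inE => /eqP->.
have genH y : H y -> S y.
  by move=> Hy; apply/SH; exists [:: y]; split=> [z|] /=;
    rewrite ?addn0 // inE => /eqP->.
have mono (P Q : nat -> Prop) : (forall x, P x -> monoid_gen Q x) ->
    forall x, monoid_gen P x -> monoid_gen Q x.
  move=> PQ x [s [Ps ->]]; elim: s Ps => [|y s IH] Ps /=; first by exists [::].
  have [s1 [Q1 ->]] := PQ y (Ps y (mem_head _ _)).
  have [|s2 [Q2 ->]] := IH; first by move=> z zs; apply: Ps; rewrite inE zs orbT.
  exists (s1 ++ s2); split; last by rewrite sumn_cat.
  by move=> z; rewrite mem_cat => /orP[/Q1|/Q2].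

pose G' x := G x /\ x <> g.
have nG' : ~ monoid_gen G' g.
  move=> gG'; suff [] : G' g by [].
  apply: (minG G') => // [x []//|x]; split.
    move/SG; apply: mono => y Gy; have [->//|/eqP yg] := eqVneq y g.
    exists [:: y]; split=> /= [z|]; last by rewrite addn0.
    by rewrite inE => /eqP->.
  by move=> h; apply/SG; apply: mono h => y [Gy _]; apply/SG; exact: genG.
have small x : S x -> (x < g)%N -> monoid_gen G' x.
  move=> /SG[s [Gs ->]] lt; exists s; split=> // y ys; split; first exact: Gs.
  move=> yg; subst y; move: lt; rewrite ltnNge => /negP[].
  elim: s ys {Gs} => //= y s IH; rewrite inE => /orP[/eqP->|/IH le].
    exact: leq_addr.
  by apply: leq_trans le _; exact: leq_addl.
have /SH [s [Hs gs]] : S g by exact: genG.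
elim: s Hs gs => [|y s IH] Hs /= gs.
  by case: nG'; rewrite gs; exists [::].
have [y0|y_gt0] := posnP y.
  by apply: IH; [move=> z zs; apply: Hs; rewrite inE zs orbT | rewrite gs y0].
have [s0|s_gt0] := posnP (sumn s).
  by rewrite gs s0 addn0; apply: Hs; rewrite mem_head.
case: nG'; rewrite [X in monoid_gen _ X]gs.
have [s1 [G1 ->]] : monoid_gen G' y.
  by apply: small; [apply/genH/Hs/mem_head | rewrite gs -[X in (X < _)%N]addn0 ltn_add2l].
have [s2 [G2 ->]] : monoid_gen G' (sumn s).
  apply: small; last by rewrite gs -[X in (X < _)%N]add0n ltn_add2r.
  by apply/SH; exists s; split=> // z zs; apply: Hs; rewrite inE zs orbT.
exists (s1 ++ s2); split; last by rewrite sumn_cat.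
by move=> z; rewrite mem_cat => /orP[/G1|/G2].
Qed.

Lemma is_width_uniq (S : nat -> Prop) (w w' : nat) :
  is_width S w -> is_width S w' -> w = w'.
Proof.
move=> [G [mG [a [b [Ga Gb ab ->]]]]] [H [mH [a' [b' [Ha Hb ab' ->]]]]].
have GH := minimal_generating_set_sub mG mH.
have HG := minimal_generating_set_sub mH mG.
have /andP[aa _] := ab _ (HG _ Ha); have /andP[_ bb] := ab _ (HG _ Hb).
have /andP[aa' _] := ab' _ (GH _ Ga); have /andP[_ bb'] := ab' _ (GH _ Gb).
have -> : a = a' by apply/eqP; rewrite eqn_leq aa aa'.
by have -> : b = b' by apply/eqP; rewrite eqn_leq bb bb'.
Qed.

Lemma quotient_dim_leq (k : fieldType) (V : lmodType k) (U W : V -> Prop)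
    (d d' : nat) :
  (forall (a : k) x y, W x -> W y -> W (a *: x + y)) ->
  quotient_dim U W d -> quotient_dim U W d' -> (d <= d')%N.
Proof.
move=> linW [b [Ub freeb _]] [b' [_ _ genb']].
have /fin_all_exists[C WC] := fun i => genb' _ (Ub i).
case: d' b' genb' C WC => [|d'] b' genb' C WC; last first.
  rewrite leqNgt; apply/negP => ltd.
  pose M : 'M[k]_(d, d'.+1) := \matrix_(i, j) C i j.
  have : kermx M != 0.
    rewrite kermx_eq0 /row_free; apply: contraL ltd => /eqP rk.
    by rewrite -leqNgt -{1}rk rank_leq_col.
  case/rowV0Pn=> v /sub_kermxP vM /eqP[]; apply/rowP=> i; rewrite mxE.
  suff Wv : W (\sum_i v 0 i *: b i) by exact: (freeb (fun i => v 0 i) Wv i).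
  have -> : \sum_i v 0 i *: b i
      = \sum_i v 0 i *: (b i - \sum_j C i j *: b' j).
    under [RHS]eq_bigr do rewrite scalerBr.
    rewrite sumrB; set T := (X in _ - X); suff -> : T = 0 by rewrite subr0.
    rewrite /T; under eq_bigr do rewrite scaler_sumr.
    rewrite exchange_big big1 //= => j _.
    under eq_bigr do rewrite scalerA.
    rewrite -scaler_suml.
    have /rowP/(_ j) := vM; rewrite !mxE => vMj.
    rewrite (_ : \sum_i _ = 0) ?scale0r // -[RHS]vMj.
    by apply: eq_bigr => l _; rewrite mxE.
  have W0 : W 0.
    have := linW (-1) _ _ (WC i) (WC i).
    by rewrite scaleN1r addNr.
  elim/big_ind: _ => // [x y Wx Wy|j _].
    by rewrite -[x]scale1r; exact: linW.
  by rewrite -[_ *: _]addr0; exact: linW.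
case: d b Ub freeb C WC => // d b Ub freeb C WC.
have : W (\sum_i (i == ord0)%:R *: b i).
  rewrite big_ord_recl /= scale1r big1 ?addr0 => [|j _].
    by have := WC ord0; rewrite big_ord0 subr0.
  by rewrite scale0r.
by move/(freeb (fun i => (i == ord0)%:R))/(_ ord0)/eqP; rewrite oner_eq0.
Qed.

Lemma quotient_dim_uniq (k : fieldType) (V : lmodType k) (U W : V -> Prop)
    (d d' : nat) :
  (forall (a : k) x y, W x -> W y -> W (a *: x + y)) ->
  quotient_dim U W d -> quotient_dim U W d' -> d = d'.
Proof.
move=> linW Ud Ud'; apply/eqP; rewrite eqn_leq.
by rewrite !(@quotient_dim_leq k V U W).
Qed.

Lemma ideal_gen_linear (R : comNzRingType) (G : R -> Prop) (a x y : R) :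
  ideal_gen G x -> ideal_gen G y -> ideal_gen G (a * x + y).
Proof.
move=> [r [c [g [Gg ->]]]] [s [d [h [Gh ->]]]].
exists (r + s)%N,
  (fun i => match split i with inl j => a * c j | inr j => d j end),
  (fun i => match split i with inl j => g j | inr j => h j end).
split=> [i|]; first by case: split.
rewrite big_split_ord mulr_sumr /=; congr (_ + _); apply: eq_bigr => j _.
  by rewrite (unsplitK (inl j)) mulrA.
by rewrite (unsplitK (inr j)).
Qed.

Lemma is_mu_uniq (k : fieldType) (N : nat) (I : {mpoly k[N]} -> Prop)
    (d d' : nat) :
  is_mu I d -> is_mu I d' -> d = d'.
Proof.
apply: quotient_dim_uniq => a x y Wx Wy.
by rewrite -mul_mpolyC; exact: ideal_gen_linear.
Qed.

(* Main.v *)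
Require Import Defs.
From mathcomp Require Import all_boot all_order all_algebra.
From mathcomp Require Import mpoly.
From mathcomp Require Import zify.
From Stdlib Require Import Classical.

(** The idea is to find more generators than necessary, but exactly as many as
    the bound allows.  The width of [S^e(m,n)] is [e - 1], so the bound is
    ['C(e, 2)], the number of pairs [1 <= i <= j < e].

    Fix, for each residue [r < e], a monomial [s r] whose weight is the least
    element of the semigroup congruent to [r] modulo [e] (an Apery element),
    with [s 0 = 1] and with every variable other than [X_0] among the [s r].
    Over [k[X_0]], where [X_0] has weight [e], the semigroup ring is free on
    the images of the [s r], so each semigroup element [t] has one normal form
    [X_0 ^ a * s (t mod e)] of weight [t].  The product [s i * s j] and the
    normal form of its weight have the same image in [k[t]]; their difference
    is the relation [F i j].

    The relations [F i j] generate the ideal.  Modulo them every monomial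
    equals the normal form of its weight, by adding one variable at a time
    ([monomial_sub_normal_form]).  Hence a polynomial [p] is congruent to
    [L (phi p)], where [L] is the linear map sending [t ^ w] to the normal form
    of [w], and [phi p = 0] leaves [p] in the ideal of the [F i j]
    ([toric_ideal_gen]).  Since [F i j = F j i] and [F 0 j = 0], the pairs
    [1 <= i <= j < e] suffice ([mu_toric_ideal_le]).

    Nothing up to this point is special to Sally type semigroups: the argument
    bounds the number of generators by ['C(e, 2)] in multiplicity [e].  What is
    specific is the list of Apery elements ([sally_apery_monomials]): [0],
    then [e + r] for the residues [r] of the generators, then [2e + m] and
    [2e + n], except that [3e + 3] replaces [2e + 3] when [(m, n) = (2, 3)]. *)

Set Implicit Arguments.
Unset Strict Implicit.
Unset Printing Implicit Defensive.

Import GRing.Theory.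

Local Open Scope ring_scope.

(** * Generators of an ideal and its minimal number of generators *)

Lemma ideal_gen_sub (R : comNzRingType) (G : R -> Prop) (x : R) :
  G x -> ideal_gen G x.
Proof.
move=> Gx; exists 1%N, (fun=> 1), (fun=> x).
by rewrite big_ord1 mul1r.
Qed.

Lemma ideal_gen0 (R : comNzRingType) (G : R -> Prop) : ideal_gen G 0.
Proof.
by exists 0%N, (fun=> 0), (fun=> 0); rewrite big_ord0; split=> // -[].
Qed.

Lemma ideal_genD (R : comNzRingType) (G : R -> Prop) (x y : R) :
  ideal_gen G x -> ideal_gen G y -> ideal_gen G (x + y).
Proof. by rewrite -{2}[x]mul1r; apply: ideal_gen_linear. Qed.

Lemma ideal_genM (R : comNzRingType) (G : R -> Prop) (a x : R) :
  ideal_gen G x -> ideal_gen G (a * x).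
Proof.
by move=> Gx; rewrite -[a * x]addr0; apply: ideal_gen_linear (ideal_gen0 G).
Qed.

(** A dependent spanning family stays spanning when a vector with nonzero
    coefficient in the dependency is dropped, so deleting vectors one by one
    must end in a basis. *)
Lemma quotient_dim_of_spanning (k : fieldType) (V : lmodType k)
    (U W : V -> Prop) (n : nat) (b : 'I_n -> V) :
    (forall (a : k) x y, W x -> W y -> W (a *: x + y)) ->
    (forall i, U (b i)) ->
    (forall u, U u -> exists c : 'I_n -> k, W (u - \sum_(i < n) c i *: b i)) ->
  exists2 d, quotient_dim U W d & (d <= n)%N.
Proof.
move=> linW; elim: n b => [|n IHn] b Ub spanb.
  by exists 0%N => //; exists b; split=> // c _ [].
have [free|] := classic (forall c : 'I_n.+1 -> k,
  W (\sum_(i < n.+1) c i *: b i) -> forall i, c i = 0).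
  by exists n.+1 => //; exists b.
move=> dep; have [c dep_c] := not_all_ex_not _ _ dep.
have [Wc c_neq0] := imply_to_and _ _ dep_c.
have [i /eqP ci0] := not_all_ex_not _ _ c_neq0.
have [||d Ud le_dn] := IHn (fun j => b (lift i j)).
- by move=> j; apply: Ub.
- move=> u /spanb[c' Wc'].
  (* Subtract the multiple of the dependency that cancels [b i]. *)
  exists (fun j => c' (lift i j) - c' i / c i * c (lift i j)).
  have := linW (c' i / c i) _ _ Wc Wc'; congr W.
  rewrite !(@bigD1_ord _ _ _ _ i) //= scalerDr scalerA divfK // addrCA.
  under [in RHS]eq_bigr do rewrite scalerBl -scalerA.
  rewrite sumrB -scaler_sumr opprB opprD; congr (_ + _).
  by rewrite addrACA subrr add0r.
by exists d => //; apply: leqW.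
Qed.

Lemma monomial_ind (N : nat) (P : 'X_{1..N} -> Prop) :
  P 0%MM -> (forall i M, P M -> P (U_(i) + M)%MM) -> forall M, P M.
Proof.
move=> P0 PS M; have [n] := ubnP (mdeg M); elim: n M => // n IHn M le_Mn.
have [->//|M0] := eqVneq M 0%MM.
have [i Mi] : exists i, M i != 0%N.
  apply/existsP; apply: contra_neqT M0 => /existsPn M0.
  by apply/mnmP => i; rewrite mnm0E; apply/eqP/negPn/M0.
have eqM : (M - U_(i) + U_(i) = M)%MM by rewrite submK ?lep1mP.
rewrite -eqM addmC; apply/PS/IHn.
by move: le_Mn; rewrite -{1}eqM mdegD mdeg1 addn1.
Qed.

(** What makes scalar coefficients enough modulo [m I]: a polynomial
    coefficient may be replaced by its constant term. *)
Lemma irrelevant_ideal_sub_const (k : fieldType) (N : nat) (p : {mpoly k[N]}) :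
  irrelevant_ideal (p - (p@_0%MM)%:MP).
Proof.
elim/mpolyind: p => [|c M p _ _ IHp].
  by rewrite mcoeff0 mpolyC0 subr0; apply: ideal_gen0.
rewrite mcoeffD mpolyCD opprD addrACA; apply: ideal_genD IHp.
elim/monomial_ind: M => [|i M _].
  rewrite mpolyX0 mcoeffZ mcoeff1 eqxx mulr1 alg_mpolyC subrr.
  exact: ideal_gen0.
rewrite mcoeffZ mcoeffX mnmD_eq0 mnm1_eq0 mulr0 mpolyC0 subr0 mpolyXD.
rewrite mulrC -mul_mpolyC mulrA.
by apply/ideal_genM/ideal_gen_sub; exists i.
Qed.

(** The easy half of Nakayama's lemma: ideal generators of [I] span [I / m I]
    over [k].  It also yields that this space is finite-dimensional. *)
Lemma is_mu_of_generators (k : fieldType) (N : nat) (I : {mpoly k[N]} -> Prop)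
    (L : seq {mpoly k[N]}) :
    (forall p, p \in L -> I p) ->
    (forall p, I p -> ideal_gen (fun q => q \in L) p) ->
  exists2 mu, is_mu I mu & (mu <= size L)%N.
Proof.
move=> IL genL.
pose b (i : 'I_(size L)) := L`_i.
set W := ideal_prod (@irrelevant_ideal k N) I.
have linW (a : k) x y : W x -> W y -> W (a *: x + y).
  by rewrite -mul_mpolyC; apply: ideal_gen_linear.
apply: (quotient_dim_of_spanning (b := b)) => // [i|u Iu].
  by apply/IL/mem_nth.
have [r [a [g [gL ->]]]] := genL u Iu; clear u Iu.
apply: (big_ind (fun u => exists c : 'I_(size L) -> k,
    W (u - \sum_(i < size L) c i *: b i))) => [|x y [c Wc] [c' Wc']|j _].
- exists (fun=> 0); rewrite big1 ?subr0 => [|i _]; last by rewrite scale0r.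
  exact: ideal_gen0.
- exists (fun i => c i + c' i).
  under eq_bigr do rewrite scalerDl.
  by rewrite big_split opprD addrACA; apply: ideal_genD.
have lt_j : (index (g j) L < size L)%N by rewrite index_mem gL.
exists (fun i => if i == Ordinal lt_j then (a j)@_0%MM else 0).
rewrite (bigD1 (Ordinal lt_j)) //= eqxx big1 ?addr0 => [|i /negPf->]; last first.
  by rewrite scale0r.
rewrite /b nth_index ?gL // -mul_mpolyC -mulrBl.
apply: ideal_gen_sub; exists (a j - ((a j)@_0%MM)%:MP), (g j); split=> //.
  exact: irrelevant_ideal_sub_const.
exact: IL.
Qed.

(** * Toric ideals and Apery monomials *)

Definition weight (N : nat) (d : 'I_N -> nat) (M : 'X_{1..N}) : nat :=
  (\sum_i M i * d i)%N.

Definition toric_ideal (k : fieldType) (N : nat) (d : 'I_N -> nat)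
    (p : {mpoly k[N]}) : Prop :=
  mmap (@polyC k) (fun i => 'X^(d i)) p = 0.

Lemma weight0 (N : nat) (d : 'I_N -> nat) : weight d 0%MM = 0%N.
Proof. by rewrite /weight big1 // => i _; rewrite mnm0E. Qed.

Lemma weightD (N : nat) (d : 'I_N -> nat) (M M' : 'X_{1..N}) :
  weight d (M + M')%MM = (weight d M + weight d M')%N.
Proof.
by rewrite /weight -big_split; apply: eq_bigr => i _; rewrite mnmDE mulnDl.
Qed.

Lemma weight1 (N : nat) (d : 'I_N -> nat) (i : 'I_N) :
  weight d U_(i)%MM = d i.
Proof.
rewrite /weight (bigD1 i) //= mnm1E eqxx mul1n big1 ?addn0 // => j.
by rewrite mnm1E eq_sym => /negPf->.
Qed.

Lemma weightMn (N : nat) (d : 'I_N -> nat) (M : 'X_{1..N}) (a : nat) :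
  weight d (M *+ a)%MM = (a * weight d M)%N.
Proof.
rewrite /weight big_distrr; apply: eq_bigr => i _ /=.
by rewrite mulmnE -mulnA mulnCA.
Qed.

Lemma mmap_monomial (k : fieldType) (N : nat) (d : 'I_N -> nat)
    (M : 'X_{1..N}) :
  mmap (@polyC k) (fun i => 'X^(d i)) 'X_[M] = 'X^(weight d M) :> {poly k}.
Proof.
rewrite mmapX /mmap1 /weight.
elim/big_rec2: _ => [|i y x _ ->]; first by rewrite expr0.
by rewrite exprD -exprM mulnC.
Qed.

(** Minimality of [weight d (s r)] in its residue class is encoded by
    subadditivity, which is a finite check; [apery_le_weight] recovers
    minimality from it. *)
Record apery_monomials (N : nat) (d : 'I_N -> nat) (e : nat) (i0 : 'I_N)
    (s : nat -> 'X_{1..N}) : Prop := {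
  apery_gt0 : (0 < e)%N;
  apery_base : d i0 = e;
  apery0 : s 0%N = 0%MM;
  apery_mod : forall r, (r < e)%N -> (weight d (s r) %% e)%N = r;
  apery_var : forall i, i != i0 -> exists2 r, (r < e)%N & s r = U_(i)%MM;
  apery_subadd : forall i j, (i < e)%N -> (j < e)%N ->
    (weight d (s ((i + j) %% e)) <= weight d (s i) + weight d (s j))%N }.

(** The monomial [X_0 ^ a * s (t mod e)] of weight [t].  The truncated
    subtraction is exact when [t] lies in the semigroup. *)
Definition normal_form (N : nat) (d : 'I_N -> nat) (e : nat) (i0 : 'I_N)
    (s : nat -> 'X_{1..N}) (t : nat) : 'X_{1..N} :=
  (U_(i0) *+ ((t - weight d (s (t %% e))) %/ e)%N + s (t %% e)%N)%MM.

Definition apery_relation (k : fieldType) (N : nat) (d : 'I_N -> nat) (e : nat)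
    (i0 : 'I_N) (s : nat -> 'X_{1..N}) (i j : nat) : {mpoly k[N]} :=
  'X_[s i + s j] - 'X_[normal_form d e i0 s (weight d (s i) + weight d (s j))%N].

(** The pairs [1 <= i <= j < e], listed by [j]; the second range [iota 1 j]
    has length [j], whence the triangular number of relations. *)
Definition apery_relations (k : fieldType) (N : nat) (d : 'I_N -> nat)
    (e : nat) (i0 : 'I_N) (s : nat -> 'X_{1..N}) : seq {mpoly k[N]} :=
  [seq apery_relation k d e i0 s i j | j <- iota 0 e, i <- iota 1 j].

Lemma size_apery_relations (k : fieldType) (N : nat) (d : 'I_N -> nat)
    (e : nat) (i0 : 'I_N) (s : nat -> 'X_{1..N}) :
  size (apery_relations k d e i0 s) = 'C(e, 2).
Proof.
rewrite size_allpairs_dep -bin2_sum /index_iota subn0 sumnE big_map.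
by apply: eq_bigr => j _; rewrite size_iota.
Qed.

Lemma apery_le_weight (N : nat) (d : 'I_N -> nat) (e : nat) (i0 : 'I_N)
    (s : nat -> 'X_{1..N}) (M : 'X_{1..N}) :
  apery_monomials d e i0 s ->
  (weight d (s (weight d M %% e)) <= weight d M)%N.
Proof.
move=> sP; elim/monomial_ind: M => [|i M IHM].
  by rewrite weight0 mod0n (apery0 sP) weight0.
rewrite weightD weight1; have [->|/(apery_var sP)[r lt_r sr]] := eqVneq i i0.
  by rewrite (apery_base sP) modnDl (leq_trans IHM) ?leq_addl.
have lt_M := ltn_pmod (weight d M) (apery_gt0 sP).
have := apery_subadd sP lt_r lt_M.
rewrite -{1}(apery_mod sP lt_r) modnDm sr weight1 => le1.
by apply: leq_trans le1 _; rewrite leq_add2l.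
Qed.

Lemma normal_formD (N : nat) (d : 'I_N -> nat) (e : nat) (i0 : 'I_N)
    (s : nat -> 'X_{1..N}) (a t : nat) :
  (0 < e)%N -> (weight d (s (t %% e)) <= t)%N ->
  normal_form d e i0 s (a * e + t)%N = (U_(i0) *+ a + normal_form d e i0 s t)%MM.
Proof.
move=> e_gt0 le_t; rewrite /normal_form modnMDl -addnBA // divnMDl //.
by rewrite addmA; congr (_ + _)%MM; apply/mnmP => i; rewrite mnmDE !mulmnE mulnDr.
Qed.

Lemma normal_form_eq (N : nat) (d : 'I_N -> nat) (e : nat) (i0 : 'I_N)
    (s : nat -> 'X_{1..N}) (t : nat) :
  apery_monomials d e i0 s -> (weight d (s (t %% e)) <= t)%N ->
  t = ((t - weight d (s (t %% e))) %/ e * e + weight d (s (t %% e)))%N.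
Proof.
move=> sP le_t; rewrite divnK ?subnK //.
by rewrite -eqn_mod_dvd // (apery_mod sP) // ltn_pmod // (apery_gt0 sP).
Qed.

Lemma weight_normal_form (N : nat) (d : 'I_N -> nat) (e : nat) (i0 : 'I_N)
    (s : nat -> 'X_{1..N}) (t : nat) :
  apery_monomials d e i0 s -> (weight d (s (t %% e)) <= t)%N ->
  weight d (normal_form d e i0 s t) = t.
Proof.
move=> sP le_t; rewrite weightD weightMn weight1 (apery_base sP).
by rewrite -(normal_form_eq sP le_t).
Qed.

Lemma apery_relation_toric (k : fieldType) (N : nat) (d : 'I_N -> nat) (e : nat)
    (i0 : 'I_N) (s : nat -> 'X_{1..N}) (i j : nat) :
  apery_monomials d e i0 s -> toric_ideal d (apery_relation k d e i0 s i j).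
Proof.
move=> sP; rewrite /toric_ideal /apery_relation mmapB !mmap_monomial -weightD.
by rewrite (weight_normal_form sP) ?subrr // (apery_le_weight _ sP).
Qed.

(** The relations with [i = 0] vanish because [s 0 = 1], and those with
    [i > j] are the listed ones with the indices exchanged. *)
Lemma apery_relation_gen (k : fieldType) (N : nat) (d : 'I_N -> nat) (e : nat)
    (i0 : 'I_N) (s : nat -> 'X_{1..N}) (i j : nat) :
  apery_monomials d e i0 s -> (i < e)%N -> (j < e)%N ->
  ideal_gen (fun q => q \in apery_relations k d e i0 s)
    (apery_relation k d e i0 s i j).
Proof.
move=> sP; wlog le_ij : i j / (i <= j)%N => [hwlog lt_i lt_j|_ lt_j].
  have [le_ij|/ltnW le_ji] := leqP i j; first exact: hwlog.
  by rewrite /apery_relation addmC addnC; apply: hwlog.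
have [->|i_gt0] := posnP i; last first.
  apply: ideal_gen_sub; apply/allpairsPdep; exists j, i.
  by rewrite !mem_iota i_gt0 lt_j add1n ltnS le_ij.
rewrite /apery_relation /normal_form (apery0 sP) weight0 add0n (apery_mod sP) //.
by rewrite subnn div0n mulm0n subrr; apply: ideal_gen0.
Qed.

(** Reduction to normal form.  If [M] reduces to [X_0 ^ a * s r], multiplying
    by [X_0] gives a normal form again, and any other variable is some [s j],
    so that one relation turns [s j * s r] into a normal form. *)
Lemma monomial_sub_normal_form (k : fieldType) (N : nat) (d : 'I_N -> nat)
    (e : nat) (i0 : 'I_N) (s : nat -> 'X_{1..N}) (M : 'X_{1..N}) :
  apery_monomials d e i0 s ->
  ideal_gen (fun q => q \in apery_relations k d e i0 s)
    ('X_[M] - 'X_[normal_form d e i0 s (weight d M)]).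
Proof.
move=> sP; have e_gt0 := apery_gt0 sP.
elim/monomial_ind: M => [|i M IHM].
  rewrite weight0 /normal_form mod0n (apery0 sP) weight0 div0n mulm0n addm0.
  by rewrite subrr; apply: ideal_gen0.
have le_M := apery_le_weight M sP.
have -> : 'X_[U_(i) + M] - 'X_[normal_form d e i0 s (weight d (U_(i) + M)%MM)]
  = 'X_i * ('X_[M] - 'X_[normal_form d e i0 s (weight d M)])
    + ('X_[U_(i) + normal_form d e i0 s (weight d M)]
        - 'X_[normal_form d e i0 s (weight d (U_(i) + M)%MM)]) :> {mpoly k[N]}.
  by rewrite mulrBr -!mpolyXD addrA subrK.
apply/ideal_genD; first exact: ideal_genM.
rewrite weightD weight1; have [->|/(apery_var sP)[j lt_j sj]] := eqVneq i i0.
  have := normal_formD i0 1 e_gt0 le_M.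
  rewrite mul1n mulm1n (apery_base sP)  => ->.
  by rewrite subrr; apply: ideal_gen0.
set t := weight d M in le_M IHM *; pose r := (t %% e)%N.
have lt_r : (r < e)%N by rewrite ltn_pmod.
set a := ((t - weight d (s r)) %/ e)%N.
have -> : (d i + t = a * e + (weight d (s j) + weight d (s r)))%N.
  by rewrite [t in LHS](normal_form_eq sP le_M) sj weight1 addnCA.
rewrite normal_formD //; last by rewrite -weightD (apery_le_weight _ sP).
have -> : (U_(i) + normal_form d e i0 s t = U_(i0) *+ a + (s j + s r))%MM.
  by rewrite /normal_form -/r -/a sj !addmA [(U_(i) + _)%MM]addmC.
rewrite !(mpolyXD _ (U_(i0) *+ a)%MM) -mulrBr.
by apply: ideal_genM; apply: apery_relation_gen sP lt_j lt_r.
Qed.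

(** Reduction of monomials extends linearly to [p = L (phi p)] modulo the
    relations, because the normal form of a monomial depends only on its
    weight, that is, on its image under [phi]. *)
Lemma toric_ideal_gen (k : fieldType) (N : nat) (d : 'I_N -> nat)
    (e : nat) (i0 : 'I_N) (s : nat -> 'X_{1..N}) (p : {mpoly k[N]}) :
  apery_monomials d e i0 s -> toric_ideal d p ->
  ideal_gen (fun q => q \in apery_relations k d e i0 s) p.
Proof.
move=> sP p0; set I := ideal_gen _.
pose L (f : {poly k}) : {mpoly k[N]} :=
  \sum_(t < size f) f`_t *: 'X_[normal_form d e i0 s t].
(* The sum may run past the size of [f]; this makes [L] visibly additive. *)
have LE n (f : {poly k}) : (size f <= n)%N ->
    L f = \sum_(t < n) f`_t *: 'X_[normal_form d e i0 s t].
  move=> le_fn; rewrite /L -!(big_mkord xpredT (fun t =>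
    f`_t *: 'X_[normal_form d e i0 s t])) [RHS](big_cat_nat _ (n := size f)) //=.
  rewrite [X in _ + X]big_nat_cond [X in _ + X]big1 ?addr0 // => t.
  by case/andP=> /andP[le_t _] _; rewrite nth_default ?scale0r.
have LD f g : L (f + g) = L f + L g.
  rewrite (LE _ _ (size_polyD f g)) (LE _ _ (leq_maxl (size f) (size g))).
  rewrite (LE _ _ (leq_maxr (size f) (size g))) -big_split.
  by apply: eq_bigr => t _; rewrite coefD scalerDl.
have LX c t : L (c *: 'X^t) = c *: 'X_[normal_form d e i0 s t].
  rewrite (LE t.+1) ?(leq_trans (size_scale_leq _ _)) ?size_polyXn //.
  rewrite big_ord_recr big1 /= ?add0r => [|u _]; rewrite coefZ coefXn.
    by rewrite eqxx mulr1.
  by rewrite ltn_eqF // mulr0 scale0r.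
suff IL q : I (q - L (mmap (@polyC k) (fun i => 'X^(d i)) q)).
  by have := IL p; rewrite [X in L X]p0 /L size_poly0 big_ord0 subr0.
elim/mpolyind: q => [|c M q _ _ IHq].
  by rewrite mmap0 /L size_poly0 big_ord0 subr0; apply: ideal_gen0.
rewrite mmapD mmapZ mmap_monomial mul_polyC LD LX opprD addrACA -scalerBr.
apply: ideal_genD IHq; rewrite -mul_mpolyC.
by apply/ideal_genM/monomial_sub_normal_form.
Qed.

(** The bound attained by semigroups of maximal embedding dimension, where all
    [s r] with [r > 0] are variables, persists when some of them are not. *)
Lemma mu_toric_ideal_le (k : fieldType) (N : nat) (d : 'I_N -> nat)
    (e : nat) (i0 : 'I_N) (s : nat -> 'X_{1..N}) :
  apery_monomials d e i0 s ->
  exists2 mu, is_mu (@toric_ideal k N d) mu & (mu <= 'C(e, 2))%N.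
Proof.
move=> sP; rewrite -(size_apery_relations k d e i0 s).
apply: is_mu_of_generators => [p /allpairsPdep[j [i [_ _ ->]]]|p].
  exact: apery_relation_toric.
exact: toric_ideal_gen.
Qed.

Local Close Scope ring_scope.

(** * Sally type semigroups *)

Lemma sally_width (e m n : nat) : 2 <= m -> m < n -> n <= e - 2 ->
  is_width (sally_semigroup e m n) (e - 1).
Proof.
move=> hm hmn hn; exists (sally_gens e m n); split; last first.
  exists e, (2 * e - 1); split; [split; lia | split; lia | by move=> x [] | lia].
split=> // H HG SH x Gx; have [/andP[le_ex le_x] _ _] := Gx.
have /SH[s [Hs eq_x]] : sally_semigroup e m n x.
  by exists [:: x]; split=> [y|]; rewrite ?inE /= ?addn0 // => /eqP->.
(* A sum of two or more generators is at least [2 * e], beyond the largest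
   generator, so no generator can be dropped. *)
have ge_e y : y \in s -> e <= y by move=> /Hs/HG[/andP[]].
case: s Hs eq_x ge_e => [|y [|z s]] Hs /= eq_x ge_e; first lia.
  by rewrite eq_x addn0; apply: Hs; rewrite mem_head.
have := ge_e y; have := ge_e z; rewrite !inE !eqxx orbT => /(_ isT) ? /(_ isT) ?.
lia.
Qed.

(** The Apery set.  The residues [m] and [n] are sums of two indices of
    generators, except [n = 3] (which forces [m = 2]): then [1 + 2] is not
    available and three copies of [e + 1] are needed. *)
Definition sally_apery_weight (e m n r : nat) : nat :=
  if r == 0 then 0 else if r == m then 2 * e + m
  else if r == n then (if n == 3 then 3 * e + n else 2 * e + n) else e + r.

(** Two nonzero residues together weigh at least [2e + i + j], which suffices
    when [i + j] wraps around [e], since then [3e + (i + j - e)] is the worst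
    case.  Without wrapping only the exceptional weight [3e + 3] could break
    the inequality, and there one of [i], [j] is [m = 2], whose weight is
    [2e + 2]. *)
Lemma sally_apery_weight_subadd (e m n i j : nat) :
    2 <= m -> m < n -> n <= e - 2 -> i < e -> j < e ->
  sally_apery_weight e m n ((i + j) %% e)
    <= sally_apery_weight e m n i + sally_apery_weight e m n j.
Proof.
move=> hm hmn hn; set w := sally_apery_weight e m n.
have w0 : w 0 = 0 by [].
have w_ge r : 0 < r -> e + r <= w r.
  by rewrite /w /sally_apery_weight; do ![case: eqP => ?]; lia.
have w_le r : w r <= 3 * e + r.
  by rewrite /w /sally_apery_weight; do ![case: eqP => ?]; lia.
have w_le2 r : n <> 3 \/ r <> 3 -> w r <= 2 * e + r.
  by rewrite /w /sally_apery_weight; do ![case: eqP => ?]; lia.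
have w_m : w m = 2 * e + m.
  by rewrite /w /sally_apery_weight; do ![case: eqP => ?]; lia.
move=> lt_i lt_j.
have [->|i_gt0] := posnP i; first by rewrite add0n modn_small // w0.
have [->|j_gt0] := posnP j; first by rewrite addn0 modn_small // w0 addn0.
have := w_ge i i_gt0; have := w_ge j j_gt0.
have [lt_ij|le_ij] := ltnP (i + j) e.
  rewrite modn_small //.
  have [[n3 ij3]|/w_le2] : (n = 3 /\ i + j = 3) \/ (n <> 3 \/ i + j <> 3) by lia.
    have m2 : m = 2 by lia.
    have := w_le (i + j); have [i2|j2] : i = 2 \/ j = 2 by lia.
      have : w i = w m by rewrite i2 m2.
      by lia.
    have : w j = w m by rewrite j2 m2.
    by lia.
  by lia.
have -> : (i + j) %% e = i + j - e.
  by rewrite -{1}(subnK le_ij) modnDr modn_small //; lia.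
by have := w_le (i + j - e); lia.
Qed.

(** Monomials realising the Apery set: [m = 1 + (m - 1)], and
    [n = 1 + (n - 1)] unless [n - 1 = m], in which case [n = 2 + (n - 2)] if
    [n > 3] and [n = 1 + 1 + 1] if [n = 3]. *)
Lemma sally_apery_monomials (e m n : nat) : 2 <= m -> m < n -> n <= e - 2 ->
  exists i0 s, apery_monomials
    (fun i : 'I_#|sally_index e m n| => e + (enum_val i : 'I_e)) e i0 s.
Proof.
move=> hm hmn hn; have e_gt0 : 0 < e by lia.
have J0 : Ordinal e_gt0 \in sally_index e m n by rewrite inE /=; lia.
(* [X r] is the variable of weight [e + r] when [r] is neither [m] nor [n]. *)
pose d (i : 'I_#|sally_index e m n|) := e + (enum_val i : 'I_e).
pose rk := enum_rank_in J0; pose X r := U_(rk (insubd (Ordinal e_gt0) r))%MM.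
have wX r : r < e -> r <> m -> r <> n -> weight d (X r) = e + r.
  move=> lt_r rm rn; rewrite weight1 /d enum_rankK_in ?val_insubd ?lt_r //.
  by rewrite inE val_insubd lt_r; lia.
pose s r := if r == 0 then 0%MM else if r == m then (X 1 + X (m - 1)%N)%MM
  else if r == n then
    if n == 3 then (X 1 *+ 3)%MM
    else if n == m.+1 then (X 2 + X (n - 2)%N)%MM
    else (X 1 + X (n - 1)%N)%MM
  else X r.
have ws r : r < e -> weight d (s r) = sally_apery_weight e m n r.
  move=> lt_r; rewrite /s /sally_apery_weight.
  by do ![case: eqP => ?]; rewrite ?weight0 ?weightD ?weightMn ?wX; lia.
exists (rk (Ordinal e_gt0)), s; split=> //.
- by rewrite /d enum_rankK_in //= addn0.
- move=> r lt_r; rewrite ws // /sally_apery_weight.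
  by do ![case: eqP => ?]; rewrite ?modnMDl ?modnDl modn_small; lia.
- move=> i i_neq; have := enum_valP i; rewrite inE => /andP[im iN].
  have i0 : (enum_val i : 'I_e) != 0 :> nat.
    apply: contra_neq i_neq => i0; rewrite -[LHS](enum_valK_in J0).
    by congr enum_rank_in; apply: val_inj.
  exists (enum_val i : 'I_e) => //.
  rewrite /s (negPf i0) (negPf im) (negPf iN) /X valKd.
  by rewrite /rk enum_valK_in.
- move=> i j lt_i lt_j; rewrite !ws ?ltn_pmod //.
  exact: sally_apery_weight_subadd.
Qed.

Unset Implicit Arguments.

Theorem corollary4p9 (k : fieldType) (e m n : nat)
    (hm : 2 <= m) (hmn : m < n) (hn : n <= e - 2) :
  exists mu wd : nat,
    [/\ is_mu (@sally_ideal k e m n) mu,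
        is_width (sally_semigroup e m n) wd
      & mu <= 'C(wd + 1, 2)].
Proof.
have [i0 [s sP]] := sally_apery_monomials hm hmn hn.
have [mu mu_I le_mu] := mu_toric_ideal_le k sP.
exists mu, (e - 1); split=> //; first exact: sally_width.
by rewrite subnK //; lia.
Qed.
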